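(* Let $X$ be a topological space and $AD(X)$ its Alexandroff duplicate. (1) If $AD(X)$ is star-Scheepers, then $X$ is star-Scheepers. (2) If $AD(X)$ is strongly star-Scheepers, then $X$ is strongly star-Scheepers.
   Context: The Alexandroff duplicate of $X$ is $AD(X)=X\times\{0,1\}$, where each point of $X\times\{1\}$ is isolated and basic neighbourhoods of $(x,0)$ are the sets $(U\times\{0\})\cup((U\times\{1\})\setminus\{(x,1)\})$ with $U$ a neighbourhood of $x$ in $X$. For $A\subseteq X$ and a family $\mathcal{P}$ of subsets of $X$, $St(A,\mathcal{P})=\bigcup\{B\in\mathcal{P} : A\cap B\neq\emptyset\}$. An $\omega$-cover of $X$ is an open cover $\mathcal{U}$ such that every finite $F\subseteq X$ is contained in some member of $\mathcal{U}$. A space $X$ is star-Scheepers if for each sequence $(\mathcal{U}_n)_{n\in\mathbb{N}}$ of open covers of $X$ there are finite $\mathcal{V}_n\subseteq\mathcal{U}_n$ such that $\{St(\bigcup\mathcal{V}_n,\mathcal{U}_n) : n\in\mathbb{N}\}$ is an $\omega$-cover of $X$ or $St(\bigcup\mathcal{V}_n,\mathcal{U}_n)=X$ for some $n$. $X$ is strongly star-Scheepers if for each sequence $(\mathcal{U}_n)_{n\in\mathbb{N}}$ of open covers of $X$ there are finite sets $F_n\subseteq X$ such that $\{St(F_n,\mathcal{U}_n) : n\in\mathbb{N}\}$ is an $\omega$-cover of $X$. *)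

(* Defs.v *)
From HB Require Import structures.
From mathcomp Require Import all_boot all_order all_algebra.
From mathcomp Require Import all_classical.
From mathcomp Require Import topology.

Set Implicit Arguments.
Unset Strict Implicit.
Unset Printing Implicit Defensive.

Local Open Scope classical_set_scope.

Definition star (X : Type) (A : set X) (P : set (set X)) : set X :=
  \bigcup_(B in [set B | P B /\ A `&` B !=set0]) B.

Definition is_open_cover (X : topologicalType) (U : set (set X)) : Prop :=
  (forall A, U A -> open A) /\ \bigcup_(A in U) A = [set: X].

(* As in the source, X itself may be a member of an omega-cover of X. *)
Definition omega_cover (X : topologicalType) (U : set (set X)) : Prop :=
  is_open_cover U /\
  forall F : set X, finite_set F -> exists2 A, U A & F `<=` A.

Definition star_Scheepers (X : topologicalType) : Prop :=
  forall U : nat -> set (set X), (forall n, is_open_cover (U n)) ->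
  exists V : nat -> set (set X),
    (forall n, finite_set (V n) /\ V n `<=` U n) /\
    (omega_cover (range (fun n => star (\bigcup_(A in V n) A) (U n))) \/
     exists n, star (\bigcup_(A in V n) A) (U n) = [set: X]).

Definition strongly_star_Scheepers (X : topologicalType) : Prop :=
  forall U : nat -> set (set X), (forall n, is_open_cover (U n)) ->
  exists F : nat -> set X,
    (forall n, finite_set (F n)) /\
    omega_cover (range (fun n => star (F n) (U n))).

(* The level X x {0} is [b = false], the level X x {1} is [b = true].
   The alias keeps this space apart from X * bool with its product topology. *)
Definition alexandroff_duplicate (X : Type) : Type := (X * bool)%type.

Section AlexandroffDuplicate.
Context {X : topologicalType}.
Local Notation AD := (alexandroff_duplicate X).

HB.instance Definition _ := Choice.on AD.

Definition AD_basic_nbhs (p : AD) : set_system AD :=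
  if p.2 then [set [set p]]
  else [set (U `*` [set false]) `|` ((U `*` [set true]) `\ (p.1, true))
       | U in nbhs p.1].

(* A set is open when it contains a basic neighbourhood of each of its points.
   This is a topology for every X.  The sets in [AD_basic_nbhs p] are themselves
   neighbourhoods of p when X is T1 (lemma [AD_nbhsE] below); for some other X,
   such as the indiscrete space on two points, no topology on X x {0,1} has all
   of them as neighbourhood bases. *)
Definition AD_open (A : set AD) : Prop :=
  forall p, A p -> exists2 N, AD_basic_nbhs p N & N `<=` A.

Let AD_openT : AD_open [set: AD].
Proof.
move=> [x []] _; first by exists [set (x, true)].
by eexists; first by exists [set: X] => //; exact: filterT.
Qed.

Let AD_openI : setI_closed AD_open.
Proof.
move=> A B Ao Bo [x []] [Ap Bp].
  by exists [set (x, true)] => // _ ->.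
have [_ [U Ux <-] UA] := Ao _ Ap; have [_ [V Vx <-] VB] := Bo _ Bp.
eexists; first by exists (U `&` V) => //; exact: filterI.
move=> q [[[Uq Vq] q2]|[[[Uq Vq] q2] qx]].
  by split; [apply: UA|apply: VB]; left.
by split; [apply: UA|apply: VB]; right.
Qed.

Let AD_open_bigU (I : Type) (f : I -> set AD) :
  (forall i, AD_open (f i)) -> AD_open (\bigcup_i f i).
Proof.
move=> fo p [i _ fip]; have [N Np Nf] := fo i p fip.
by exists N => // q /Nf fiq; exists i.
Qed.

HB.instance Definition _ :=
  isOpenTopological.Build AD AD_openT AD_openI AD_open_bigU.

Lemma AD_openE (A : set AD) : open A = AD_open A.
Proof. by []. Qed.

Lemma AD_open_isolated (x : X) : open [set ((x, true) : AD)].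
Proof. by rewrite AD_openE => _ ->; exists [set (x, true)]. Qed.

Lemma AD_nbhsE (p : AD) : accessible_space X ->
  nbhs p = filter_from (AD_basic_nbhs p) id.
Proof.
move=> X1; apply/seteqP; split=> A.
  rewrite nbhsE => -[B [Bo Bp] BA].
  have [N Np NB] := Bo p Bp; exists N => //.
  exact: subset_trans BA.
case: p => x [] [N].
  move=> -> NA; rewrite nbhsE; exists [set (x, true)] => //.
  by split=> //; exact: AD_open_isolated.
move=> [U Ux <-] UA; move: Ux; rewrite nbhsE => -[V [Vo Vx] VU].
rewrite nbhsE.
exists ((V `*` [set false]) `|` ((V `*` [set true]) `\ (x, true))); last first.
  move=> q [[Vq q2]|[[Vq q2] qx]]; apply: UA; first by left; split=> //; exact: VU.
  by right; split=> //; split=> //; exact: VU.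
split; last by left.
move=> [y b] [[/= Vy ->]|[[/= Vy ->] yx]]; last first.
  by exists [set (y, true)] => // _ ->; right.
have [->|/eqP yx] := pselect (y = x).
  by eexists; first by exists V => //; exact: open_nbhs_nbhs.
have [W [Wo]] := X1 _ _ yx; rewrite !inE => Wy Wx.
eexists.
  exists (V `&` W) => //.
  by apply: filterI; exact: open_nbhs_nbhs.
move=> [z c] [[[Vz Wz] c2]|[[[Vz Wz] c2] zy]]; first by left.
by right; split=> //= -[zx _]; apply: Wx; rewrite -zx.
Qed.

End AlexandroffDuplicate.

(* Main.v *)
(** Both properties pass to continuous surjective images [f : Y -> X]: pull each
    cover of [X] back along [f]; the star of [A] in the pulled back cover is the
    preimage of the star of [f @` A], so the selections in [Y] push forward to
    [X].  The projection of the Alexandroff duplicate is such a map. *)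
Require Import Defs.
From HB Require Import structures.
From mathcomp Require Import all_boot all_order all_algebra.
From mathcomp Require Import all_classical.
From mathcomp Require Import topology.

Local Open Scope classical_set_scope.

(** [A] meets the preimage of [B] exactly when the image of [A] meets [B], so both sides select the
    same members of [P]. *)
Lemma star_preimage (X Y : Type) (f : Y -> X) (A : set Y) (P : set (set X)) :
  star A (preimage f @` P) = f @^-1` star (f @` A) P.
Proof.
apply/seteqP; split=> y.
  move=> [_ [[B PB <-] [z [Az fzB]]] fyB]; exists B => //.
  by split=> //; exists (f z); split=> //; exists z.
move=> [B [PB [_ [[z Az <-]] fzB]] fyB]; exists (f @^-1` B) => //.
by split; [exists B|exists z].
Qed.

Lemma star_open (X : topologicalType) (A : set X) (P : set (set X)) :
  is_open_cover P -> open (star A P).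
Proof. by move=> [Po _]; apply: bigcup_open => B [/Po]. Qed.

Section ContinuousSurjection.
Variables (X Y : topologicalType) (f : Y -> X).
Hypotheses (f_cont : continuous f) (f_surj : range f = [set: X]).

Lemma is_open_cover_preimage (P : set (set X)) :
  is_open_cover P -> is_open_cover (preimage f @` P).
Proof.
move=> [Po Pcov]; split=> [_ [B PB <-]|].
  by apply: open_comp (Po _ PB) => y _; exact: f_cont.
by rewrite bigcup_image -preimage_bigcup Pcov preimage_setT.
Qed.

(** Openness of each [W n] is assumed separately: for a merely continuous surjection it does not
    follow from openness of the preimage. *)
Lemma omega_cover_preimage (W : nat -> set X) : (forall n, open (W n)) ->
  omega_cover (range (fun n => f @^-1` W n)) -> omega_cover (range W).
Proof.
move=> Wo [_ Wfin].
have finW (F : set X) : finite_set F -> exists2 A, range W A & F `<=` A.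
  (* A right inverse [g] of [f] lifts [F] to a finite subset of [Y]; if the preimage of [W n]
     contains the lift, then [W n] contains [F]. *)
  have /choice[g gK] : forall x, exists y, f y = x.
    move=> x; have : [set: X] x by [].
    by rewrite -f_surj => -[y _ <-]; exists y.
  move=> /(finite_image g)/Wfin[_ [n _ <-]] gFW.
  exists (W n) => [|x Fx]; first by exists n.
  by rewrite -(gK x); apply: gFW; exists x.
split=> //; split=> [_ [n _ <-] //|].
(* Covering is the finite case applied to singletons. *)
apply/seteqP; split=> // x _.
by have [A WA xA] := finW _ (finite_set1 x); exists A => //; exact: xA.
Qed.

Lemma star_Scheepers_image : star_Scheepers Y -> star_Scheepers X.
Proof.
move=> SY U Ucov.
have [V [VU Vstar]] := SY _ (fun n => is_open_cover_preimage _ (Ucov n)).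
pose V' n := image ^~ f @` V n.
have starE n : star (\bigcup_(A in V n) A) (preimage f @` U n) =
    f @^-1` star (\bigcup_(A in V' n) A) (U n).
  by rewrite star_preimage image_bigcup bigcup_image.
exists V'; split=> [n|].
  have [Vfin VUn] := VU n; split; first exact: finite_image.
  (* By surjectivity the image of the preimage of [B] is [B] itself, so the pushed forward sets
     belong to [U n]. *)
  by move=> _ [C /VUn[B UB <-] <-]; rewrite image_preimage.
case: Vstar => [Vstar|[n Vn]]; [left|right].
  apply: omega_cover_preimage => [n|]; first exact: star_open.
  by under eq_fun do rewrite -starE.
exists n; apply/seteqP; split=> // x _.
have : [set: X] x by [].
by rewrite -f_surj => -[y _ <-]; have : [set: Y] y by []; rewrite -Vn starE.
Qed.

Lemma strongly_star_Scheepers_image :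
  strongly_star_Scheepers Y -> strongly_star_Scheepers X.
Proof.
move=> SY U Ucov.
have [F [Ffin Fstar]] := SY _ (fun n => is_open_cover_preimage _ (Ucov n)).
exists (fun n => f @` F n); split=> [n|]; first exact: finite_image.
apply: omega_cover_preimage => [n|]; first exact: star_open.
by under eq_fun do rewrite -star_preimage.
Qed.

End ContinuousSurjection.

Lemma AD_fst_continuous (X : topologicalType) :
  continuous (fst : alexandroff_duplicate X -> X).
Proof.
apply/continuousP => A Ao; rewrite AD_openE => -[x []] Ax.
  by exists [set (x, true)] => // _ ->.
(* At [(x, false)] the open set [A] itself serves as the neighbourhood of [x]: both levels of the
   resulting basic set project into [A]. *)
eexists; first by exists A => //; exact: open_nbhs_nbhs.
by move=> q [[]|[[]]].
Qed.

Lemma AD_fst_surjective (X : topologicalType) :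
  range (fst : alexandroff_duplicate X -> X) = [set: X].
Proof. by apply/seteqP; split=> // x _; exists (x, false). Qed.

Theorem theorem3p32 (X : topologicalType) :
  (star_Scheepers (alexandroff_duplicate X) -> star_Scheepers X) /\
  (strongly_star_Scheepers (alexandroff_duplicate X) ->
     strongly_star_Scheepers X).
Proof.
have fst_cont := @AD_fst_continuous X; have fst_surj := AD_fst_surjective X.
split; first exact: star_Scheepers_image fst_cont fst_surj.
exact: strongly_star_Scheepers_image fst_cont fst_surj.
Qed.
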